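(* Let $d \ge 1$ and suppose that $X^{(n)} = (X_1^{(n)}, \ldots, X_d^{(n)})$, $n \ge 1$, and $X = (X_1, \ldots, X_d)$ are random vectors in $\mathbb{R}^d$ such that, as $n\to\infty$, $$\sum_{i=1}^d t_i X_i^{(n)} \xrightarrow{d} \sum_{i=1}^d t_i X_i$$ for all real numbers $t_1, \ldots, t_d \ge 0$. Suppose, further, that the distribution of $X$ is determined by its moments. Then $X^{(n)} \xrightarrow{d} X$ as $n\to\infty$. (Hence the displayed convergence holds for all real $t_1, \ldots, t_d$.)
   Context: $\xrightarrow{d}$ denotes convergence in distribution. A random vector in $\mathbb{R}^d$ (or its distribution) is determined by its moments if all its mixed moments are finite and every random vector in $\mathbb{R}^d$ with the same mixed moments has the same distribution. *)

(* Defs.v *)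
From HB Require Import structures.
From mathcomp Require Import all_boot all_order all_algebra.
From mathcomp Require Import all_classical all_reals all_analysis.

Set Implicit Arguments.
Unset Strict Implicit.
Unset Printing Implicit Defensive.

Import Order.TTheory GRing.Theory Num.Theory.
Import numFieldNormedType.Exports.

Local Open Scope classical_set_scope.
Local Open Scope ring_scope.

Notation borel E := (g_sigma_algebraType (@open E)).

(* The topology of ['rV[R]_d] is the product topology, that is, the usual one
   of R^d. *)
Notation "{ 'RVec' P >-> R ^ d }" := {RV P >-> borel 'rV[R]_d}
  (at level 0, R at level 1, d at level 1) : form_scope.

Section cvg_distribution.
Context {R : realType} {E : topologicalType}.

(* Convergence in distribution: E f(X_n) -> E f(X) for every bounded continuous
   real f.  The X_n need not live on the same probability space.  The definition
   makes sense for maps that are measurable with respect to the Borel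
   sigma-algebra of [E]. *)
Definition cvg_in_distribution
    (dn : nat -> measure_display) (Tn : forall n, measurableType (dn n))
    (Pn : forall n, probability (Tn n) R) (Xn : forall n, Tn n -> E)
    (d0 : measure_display) (T : measurableType d0)
    (P : probability T R) (X : T -> E) : Prop :=
  forall f : E -> R, continuous f -> bounded_fun f ->
    'E_(Pn n)[fun w => f (Xn n w)]%E @[n --> \oo] --> 'E_P[fun w => f (X w)]%E.

End cvg_distribution.

Section random_vectors.
Context {R : realType} {d : nat}.

Definition lin_comb (t : 'I_d -> R) (x : 'rV[R]_d) : R :=
  \sum_(i < d) t i * x ord0 i.

Definition monomial (k : 'I_d -> nat) (x : 'rV[R]_d) : R :=
  \prod_(i < d) x ord0 i ^+ k i.

Section one_vector.
Context {d0 : measure_display} {T : measurableType d0} (P : probability T R).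
Variable X : {RVec P >-> R ^ d}.

Definition mixed_moment (k : 'I_d -> nat) : \bar R :=
  'E_P[fun w => monomial k (X w)]%E.

Definition finite_mixed_moments : Prop :=
  forall k : 'I_d -> nat,
    P.-integrable [set: T] (fun w => (monomial k (X w))%:E).

End one_vector.

(* The laws are compared on Borel sets only: [distribution] is a function on all
   sets, measurable or not. *)
Definition same_distribution
    (d1 : measure_display) (T1 : measurableType d1) (P1 : probability T1 R)
    (X1 : {RVec P1 >-> R ^ d})
    (d2 : measure_display) (T2 : measurableType d2) (P2 : probability T2 R)
    (X2 : {RVec P2 >-> R ^ d}) : Prop :=
  forall A : set (borel 'rV[R]_d), measurable A ->
    distribution P1 X1 A = distribution P2 X2 A.

Definition determined_by_moments
    (d0 : measure_display) (T : measurableType d0) (P : probability T R)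
    (X : {RVec P >-> R ^ d}) : Prop :=
  finite_mixed_moments X /\
  forall (d1 : measure_display) (T1 : measurableType d1)
      (P1 : probability T1 R) (Y : {RVec P1 >-> R ^ d}),
    finite_mixed_moments Y ->
    (forall k : 'I_d -> nat, mixed_moment Y k = mixed_moment X k) ->
    same_distribution Y X.

End random_vectors.

(* Main.v *)
Require Import Defs.
From HB Require Import structures.
From mathcomp Require Import all_boot all_order all_algebra.
From mathcomp Require Import all_classical all_reals all_analysis.
From mathcomp Require Import measurable_realfun lra.
Import Order.TTheory GRing.Theory Num.Theory.
Import numFieldNormedType.Exports.
Set Implicit Arguments.
Unset Strict Implicit.
Local Open Scope classical_set_scope.
Local Open Scope ring_scope.

(* Along an ultrafilter U on nat finer than the Frechet filter, the expectations
   E f(X^(n)) of bounded continuous f converge to some L f, where L is a positive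
   normalized linear functional.  The hypothesis at t = e_i makes L tight, so by
   Dini's theorem L is continuous along decreasing sequences, and a Daniell-Riesz
   construction gives a random vector Y with L f = E f(Y).  For t >= 0, <t,Y> and
   <t,X> then have the same law, hence the same moments; by polarization every
   monomial is a linear combination of powers <t,.>^m with t >= 0, so Y and X
   have the same mixed moments, and Y has the law of X.  As the limit E f(X) does
   not depend on U, E f(X^(n)) converges to it. *)

(** * Bounded continuous test functions *)

Section bounded_continuous.
Context {R : realType} {E : topologicalType}.
Implicit Types f g : E -> R.

Definition bcont f := continuous f /\ exists M : R, forall x, `|f x| <= M.

Definition unit_cont f := continuous f /\ forall x, 0 <= f x <= 1.

Lemma bcont_bounded f : continuous f -> bounded_fun f -> bcont f.
Proof.
move=> cf /pinfty_ex_gt0[M _ fM]; split => //; exists M => x; exact: fM.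
Qed.

Lemma bounded_bcont f : bcont f -> bounded_fun f.
Proof.
move=> [_ [M fM]]; rewrite /= /bounded_near; near=> N => x _ /=.
apply: le_trans (fM x) _; near: N; apply: nbhs_pinfty_ge; exact: num_real.
Unshelve. all: by end_near. Qed.

Lemma unit_bcont f : unit_cont f -> bcont f.
Proof.
by move=> [cf f01]; split => //; exists 1 => x; have /andP[f0 f1] := f01 x;
  rewrite ger0_norm.
Qed.

Lemma bcont_cst (c : R) : bcont (fun=> c).
Proof. by split; [move=> x; exact: cvg_cst | exists `|c|]. Qed.

Lemma bcontD f g : bcont f -> bcont g -> bcont (fun x => f x + g x).
Proof.
move=> [cf [M fM]] [cg [N gN]]; split.
  by move=> x; apply: cvgD; [exact: cf | exact: cg].
by exists (M + N) => x; rewrite (le_trans (ler_normD _ _))// lerD.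
Qed.

Lemma bcontZ c f : bcont f -> bcont (fun x => c * f x).
Proof.
move=> [cf [M fM]]; split.
  by move=> x; apply: cvgM; [exact: cvg_cst | exact: cf].
by exists (`|c| * M) => x; rewrite normrM ler_wpM2l.
Qed.

Lemma bcontN f : bcont f -> bcont (fun x => - f x).
Proof.
move=> bf; rewrite (_ : (fun _ => _) = fun x => -1 * f x); first exact: bcontZ.
by apply/funext => x; rewrite mulN1r.
Qed.

Lemma bcontB f g : bcont f -> bcont g -> bcont (fun x => f x - g x).
Proof. by move=> bf bg; apply: bcontD => //; exact: bcontN. Qed.

Lemma bcont_sum (I : Type) (r : seq I) (h : I -> E -> R) :
  (forall i, bcont (h i)) -> bcont (fun x => \sum_(i <- r) h i x).
Proof.
move=> bh; elim: r => [|i r IHr].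
  by under eq_fun do rewrite big_nil; exact: bcont_cst.
by under eq_fun do rewrite big_cons; exact: bcontD.
Qed.

Lemma continuous_minr f g : continuous f -> continuous g ->
  continuous (fun x => Num.min (f x) (g x)).
Proof. by move=> cf cg x; apply: continuous_min; [exact: cf|exact: cg]. Qed.

Lemma continuous_maxr f g : continuous f -> continuous g ->
  continuous (fun x => Num.max (f x) (g x)).
Proof. by move=> cf cg x; apply: continuous_max; [exact: cf|exact: cg]. Qed.

Lemma unit_cont_min f g : unit_cont f -> continuous g -> (forall x, 0 <= g x) ->
  unit_cont (fun x => Num.min (f x) (g x)).
Proof.
move=> [cf f01] cg g0; split; first exact: continuous_minr.
by move=> x; rewrite le_min ge_min g0; have /andP[-> ->] := f01 x.
Qed.

Lemma unit_cont1 : unit_cont (fun=> 1).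
Proof. by split; [move=> x; exact: cvg_cst | move=> x; rewrite ler01 lexx]. Qed.

Lemma unit_cont0 : unit_cont (fun=> 0).
Proof. by split; [move=> x; exact: cvg_cst | move=> x; rewrite ler01 lexx]. Qed.

End bounded_continuous.

Lemma continuous_contract {R : realType} : continuous (@contract R).
Proof.
move=> x; apply/cvgrPdist_lt => e e0; near=> y.
by near: y; have := nbhsx_ballx x e e0.
Unshelve. all: by end_near. Qed.

(** The form in which metrizability enters the Riesz construction: indicators of open sets become
    increasing limits of continuous functions. *)
Definition open_cozero (R : realType) (E : topologicalType) := forall G : set E,
  open G -> exists2 g : E -> R, continuous g &
    (forall x, 0 <= g x) /\ G = [set x | 0 < g x].

Lemma pseudometric_open_cozero {R : realType} {E : pseudoMetricType R} :
  open_cozero R E.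
Proof.
move=> G oG; pose d := edist_inf (~` G).
have contract_gt0 x : (0 < contract x) = (0 < x :> \bar R)%E.
  by rewrite -{1}(@contract0 R) lt_contract.
(* The distance to the complement can be infinite, for instance when [G] is the whole space;
   [contract] makes it real without changing its sign. *)
exists (@contract R \o d); [|split].
- move=> x; apply: continuous_comp; first exact: edist_inf_continuous.
  exact: continuous_contract.
- by move=> x /=; rewrite -(@contract0 R) le_contract edist_inf_ge0.
- apply/seteqP; split => x /=; rewrite contract_gt0.
  + move=> Gx; have /nbhs_ballP[e /= e0 eG] : nbhs x G by exact: open_nbhs_nbhs.
    apply: (@lt_le_trans _ _ e%:E) => //.
    apply: le_ereal_inf_tmp => _ [y Gy <-].
    rewrite leNgt; apply/negP => xye; apply: Gy; apply: eG.
    exact: (@edist_lt_ball _ _ _ (x, y)).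
  + by move=> dx; apply: contrapT => Gx; move: dx; rewrite /d edist_inf0// ltxx.
Qed.

(** * Positive normalized linear functionals *)

Section mean.
Context {R : realType} {E : topologicalType}.
Implicit Types (f g : E -> R) (L : (E -> R) -> R).

(* Only the values of [L] on [bcont] functions matter. *)
Record mean L : Prop := Mean {
  meanD : forall f g, bcont f -> bcont g -> L (fun x => f x + g x) = L f + L g ;
  meanZ : forall c f, bcont f -> L (fun x => c * f x) = c * L f ;
  mean_ge0 : forall f, bcont f -> (forall x, 0 <= f x) -> 0 <= L f ;
  mean1 : L (fun=> 1) = 1 }.

Context L (mL : mean L).

Lemma mean_cst c : L (fun=> c) = c.
Proof.
rewrite (_ : (fun=> c) = fun=> c * 1); last by apply/funext => x; rewrite mulr1.
by rewrite (meanZ mL) ?(mean1 mL) ?mulr1//; exact: bcont_cst.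
Qed.

Lemma meanB f g : bcont f -> bcont g -> L (fun x => f x - g x) = L f - L g.
Proof.
move=> bf bg; rewrite (meanD mL)//; last exact: bcontN.
rewrite -(mulN1r (L g)) -(meanZ mL)//; congr (_ + L _).
by apply/funext => x; rewrite mulN1r.
Qed.

Lemma mean_le f g : bcont f -> bcont g -> (forall x, f x <= g x) -> L f <= L g.
Proof.
move=> bf bg fg; rewrite -subr_ge0 -meanB//; apply: (mean_ge0 mL).
  exact: bcontB.
by move=> x; rewrite subr_ge0.
Qed.

Lemma mean_sum (I : Type) (r : seq I) (h : I -> E -> R) :
  (forall i, bcont (h i)) ->
  L (fun x => \sum_(i <- r) h i x) = \sum_(i <- r) L (h i).
Proof.
move=> bh; elim: r => [|i r IHr].
  by under eq_fun do rewrite big_nil; rewrite mean_cst big_nil.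
under eq_fun do rewrite big_cons.
by rewrite (meanD mL)//; [rewrite IHr big_cons|exact: bcont_sum].
Qed.

Lemma mean_unit f : unit_cont f -> 0 <= L f <= 1.
Proof.
move=> uf; have bf := unit_bcont uf; apply/andP; split.
  by apply: (mean_ge0 mL) => // x; have /andP[] := uf.2 x.
by rewrite -(mean_cst 1); apply: mean_le => // [|x];
  [exact: bcont_cst | have /andP[] := uf.2 x].
Qed.

(** Daniell's continuity condition, from which countable additivity will come. *)
Definition smooth_mean := forall f : nat -> E -> R,
  (forall k, unit_cont (f k)) -> (forall k x, f k.+1 x <= f k x) ->
  (forall x, f ^~ x @ \oo --> (0 : R)) -> L \o f @ \oo --> (0 : R).

End mean.

(** * Riesz representation *)

Section riesz.
Context {R : realType} {E : ptopologicalType} (coz : open_cozero R E).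
Context (L : (E -> R) -> R) (mL : mean L) (sL : smooth_mean L).
Implicit Types (G A : set E).
Local Open Scope ereal_scope.

(** [inner] prescribes the measure of open sets and [outer] extends it to all sets by outer
    regularity; Carathéodory's construction then gives a Borel measure. *)
Let below G := [set f : E -> R | unit_cont f /\ [set x | 0 < f x]%R `<=` G].

Let inner G : \bar R := ereal_sup [set (L f)%:E | f in below G].

Let outer A : \bar R :=
  ereal_inf [set inner G | G in [set G | open G /\ A `<=` G]].

Let le_inner G f : below G f -> (L f)%:E <= inner G.
Proof. by move=> bf; apply: ereal_sup_ubound; exists f. Qed.

Let inner_ge0 G : 0 <= inner G.
Proof.
have -> : 0 = (L (fun=> 0%R))%:E by rewrite (mean_cst mL).
apply: le_inner; split; first exact: unit_cont0.
by move=> x /=; rewrite ltxx.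
Qed.

Let inner_mono G G' : G `<=` G' -> inner G <= inner G'.
Proof.
move=> GG'; apply: ge_ereal_sup => _ [f [uf fG] <-].
by apply: le_inner; split => //; exact: subset_trans GG'.
Qed.

Let inner_set0 : inner set0 = 0.
Proof.
apply/eqP; rewrite eq_le inner_ge0 andbT; apply: ge_ereal_sup => _ [f [uf f0] <-].
rewrite (_ : f = fun=> 0%R) ?(mean_cst mL)//.
apply/funext => x; apply/eqP; rewrite eq_le leNgt.
by have /andP[-> _] := uf.2 x; rewrite andbT; apply/negP => /f0.
Qed.

Let inner_setT : inner setT = 1.
Proof.
apply/eqP; rewrite eq_le; apply/andP; split.
  apply: ge_ereal_sup => _ [f [uf _] <-].
  by rewrite lee_fin; have /andP[] := mean_unit mL uf.
have -> : 1 = (L (fun=> 1%R))%:E by rewrite (mean_cst mL).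
by apply: le_inner; split => //; exact: unit_cont1.
Qed.

(** Daniell's condition is used here: a function [f] below the union is exhausted by functions
    [h m], and the remainders [r m] decrease pointwise to 0, hence so do their means. *)
Let inner_sub (G : nat -> set E) : (forall k, open (G k)) ->
  inner (\bigcup_k G k) <= \sum_(k <oo) inner (G k).
Proof.
move=> oG; apply: ge_ereal_sup => _ [f [uf fG] <-].
have /choice[g gP] : forall k, exists g : E -> R, continuous g /\
    (forall x, 0 <= g x)%R /\ G k = [set x | 0 < g x]%R.
  move=> k; by have [g] := coz (oG k); exists g.
(* As [m] grows, [t m k] increases to the indicator of [G k]. *)
pose t m k x := Num.min 1%R (m%:R * g k x)%R.
have t0 m k x : (0 <= t m k x)%R.
  by rewrite le_min ler01 mulr_ge0//; exact: (gP k).2.1.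
have ut m k : unit_cont (t m k).
  apply: unit_cont_min; first exact: unit_cont1.
    by move=> x; apply: cvgM; [exact: cvg_cst|exact: (gP k).1].
  by move=> x; rewrite mulr_ge0//; exact: (gP k).2.1.
pose s m x := (\sum_(k < m) t m k x)%R.
have bs m : bcont (s m) by apply: bcont_sum => k; exact: unit_bcont.
have s0 m x : (0 <= s m x)%R by exact: sumr_ge0.
have s_mono m x : (s m x <= s m.+1 x)%R.
  rewrite /s big_ord_recr/= -[leLHS]addr0 lerD//; apply: ler_sum => k _.
  rewrite le_min /t ge_min lexx/= ge_min.
  rewrite (_ : (m%:R * g k x <= _)%R) ?orbT//.
  by rewrite ler_wpM2r ?ler_nat//; exact: (gP k).2.1.
(* [h m] increases to [f], and is dominated by a sum of functions carried by
   [G 0], ..., [G (m - 1)]. *)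
pose h m x := Num.min (f x) (s m x).
have uh m : unit_cont (h m) by apply: unit_cont_min => //; exact: (bs m).1.
pose r m x := (f x - h m x)%R.
have ur m : unit_cont (r m).
  split; first by have [] := bcontB (unit_bcont uf) (unit_bcont (uh m)).
  move=> x; rewrite /r subr_ge0 ge_min lexx/=.
  have /andP[_ f1] := uf.2 x; have /andP[h0 _] := (uh m).2 x.
  by rewrite lerBlDr (le_trans f1)// lerDl.
have Lr : L \o r @ \oo --> (0%R : R).
  apply: sL => //.
  - by move=> m x; rewrite /r lerB// le_min !ge_min lexx/= s_mono orbT.
  - move=> x; have [f0|f0] := leP (f x) 0%R.
      apply: cvg_near_cst; apply: nearW => m.
      rewrite /r /h min_l ?subrr//.
      exact: le_trans (s0 m x).
    (* Once [m > k] and [m >= 1 / g k x], the term of index [k] in [s m x] is 1, which is at least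
       [f x], so [r m x] vanishes. *)
    have [k _] := fG x f0; rewrite (gP k).2.2 /= => gk0.
    apply: cvg_near_cst; near=> m.
    rewrite /r /h min_l ?subrr//.
    have /andP[_ /le_trans] := uf.2 x; apply.
    have km : (k < m)%N by near: m; exact: nbhs_infty_gt.
    rewrite /s (bigD1 (Ordinal km))//= -[leLHS]addr0 lerD//; last exact: sumr_ge0.
    rewrite le_min lexx/= -ler_pdivrMr// div1r.
    by near: m; exact: nbhs_infty_ger.
apply/lee_addgt0Pr => e e0.
have [m _ /(_ m (leqnn m))/= rme] : \forall m \near \oo, (L (r m) < e)%R.
  exact: (cvgr_lt 0%R).
have -> : L f = (L (h m) + L (r m))%R.
  rewrite -(meanD mL) ?(unit_bcont (uh m)) ?(unit_bcont (ur m))//.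
    by congr L; apply/funext => x; rewrite /r addrC subrK.
  - exact: unit_bcont.
  - exact: unit_bcont.
rewrite EFinD leeD//; last by rewrite lee_fin ltW.
apply: (@le_trans _ _ (\sum_(k < m) inner (G k))).
  apply: (@le_trans _ _ (L (s m))%:E).
    rewrite lee_fin; apply: (mean_le mL) => //; first exact: unit_bcont.
    by move=> x; rewrite ge_min lexx orbT.
  rewrite (mean_sum mL); last by move=> k; exact: unit_bcont.
  rewrite -sumEFin; apply: lee_sum => k _; apply: le_inner; split => //.
  move=> x /=; rewrite lt_min ltr01/= (gP k).2.2/= => mg.
  rewrite lt_neqAle (gP k).2.1 andbT eq_sym.
  by apply: contraTneq mg => ->; rewrite mulr0 ltxx.
rewrite -(big_mkord xpredT (fun k => inner (G k))).
exact: nneseries_lim_ge.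
Unshelve. all: by end_near. Qed.

Let outer_open G : open G -> outer G = inner G.
Proof.
move=> oG; apply/eqP; rewrite eq_le; apply/andP; split.
  by apply: ereal_inf_lbound; exists G => //; split.
by apply: le_ereal_inf_tmp => _ [H [_ GH] <-]; exact: inner_mono.
Qed.

Let outer_set0 : outer set0 = 0.
Proof. by rewrite outer_open ?inner_set0//; exact: open0. Qed.

Let outer_ge0 A : 0 <= outer A.
Proof. by apply: le_ereal_inf_tmp => _ [G _ <-]. Qed.

Let outer_mono : {homo outer : A B / A `<=` B >-> A <= B}.
Proof.
move=> A B AB; apply: ereal_inf_le_tmp => _ [G [oG BG] <-]; exists G => //.
by split => //; exact: subset_trans BG.
Qed.

Let outer_le1 A : outer A <= 1.
Proof.
rewrite -inner_setT -outer_open; last exact: openT.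
exact: outer_mono.
Qed.

Let outer_fin A : outer A \is a fin_num.
Proof. by rewrite ge0_fin_numE// (le_lt_trans (outer_le1 A))// ltry. Qed.

Let outer_sub : sigma_subadditive outer.
Proof.
move=> A; apply/lee_addgt0Pr => e e0.
rewrite (le_trans _ (epsilon_trick _ _ (ltW e0)))//.
have /choice[G GP] : forall n, exists G : set E, [/\ open G, A n `<=` G &
    inner G <= outer (A n) + (e / (2 ^ n.+1)%:R)%:E].
  move=> n; have en : (0 < e / (2 ^ n.+1)%:R)%R by rewrite divr_gt0// ltr0n expn_gt0.
  have [_ [G [oG AG] <-] /ltW ?] := lb_ereal_inf_adherent en (outer_fin (A n)).
  by exists G.
apply: (@le_trans _ _ (inner (\bigcup_n G n))).
  apply: ereal_inf_lbound; exists (\bigcup_n G n) => //; split.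
    by apply: bigcup_open => n _; have [] := GP n.
  by apply: subset_bigcup => n _; have [] := GP n.
apply: (@le_trans _ _ (\sum_(n <oo) inner (G n))).
  by apply: inner_sub => n; have [] := GP n.
by apply: lee_nneseries => n _ //; have [] := GP n.
Qed.

HB.instance Definition _ := isOuterMeasure.Build R E outer
  outer_set0 outer_ge0 outer_mono outer_sub.

(** Outer regularity replaces the test set by an open [V], and the part of [V] outside [G] by an
    open [H]. It remains to add a function below [H] to a slightly lowered function below the part
    of [V] inside [G]. *)
Let open_caratheodory G : open G -> outer.-caratheodory G.
Proof.
move=> oG; apply: le_caratheodory_measurable => A.
apply: le_ereal_inf_tmp => _ [V [oV AV] <-].
apply: (@le_trans _ _ (inner (V `&` G) + outer (V `\` G))).
  rewrite -setDE leeD//; last by apply: outer_mono; exact: setSD.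
  rewrite -outer_open; last exact: openI.
  by apply: outer_mono; exact: setSI.
rewrite -leeBrDr//.
apply: ge_ereal_sup => _ [f [uf fVG] <-].
rewrite leeBrDr// -leeBrDl//.
apply/lee_addgt0Pr => d d0.
(* The positive part of [f - d] is carried by the closed set [f >= d], so a
   function carried by the open set [H] can be added to it. *)
pose f' x := Num.max (f x - d)%R 0%R.
pose H := V `&` [set x | f x < d]%R.
have oH : open H.
  apply: openI => //; apply: (@open_comp _ _ f [set y | y < d]%R).
    by move=> x _; exact: uf.1.
  exact: open_lt.
have VGH : V `\` G `<=` H.
  move=> x [Vx Gx]; split => //=; rewrite ltNge; apply/negP => dfx.
  by apply: Gx; apply: (fVG x _).2 => /=; exact: lt_le_trans dfx.
apply: (@le_trans _ _ (inner H)); first by rewrite -outer_open//; exact: outer_mono.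
apply: ge_ereal_sup => _ [g [ug gH] <-].
have uf' : unit_cont f'.
  split.
    apply: continuous_maxr; last by move=> x; exact: cvg_cst.
    by have [] := bcontB (unit_bcont uf) (bcont_cst d).
  move=> x; rewrite le_max lexx orbT ge_max ler01 andbT/= lerBlDr.
  by have /andP[_ /le_trans] := uf.2 x; apply; rewrite lerDl ltW.
have bfg : below V (fun x => f' x + g x)%R.
  split.
    split; first by have [] := bcontD (unit_bcont uf') (unit_bcont ug).
    move=> x; have /andP[g0 g1] := ug.2 x; have /andP[f'0 f'1] := uf'.2 x.
    rewrite addr_ge0//=; have [gx|gx] := leP (g x) 0%R.
      by rewrite -[leRHS]addr0 lerD.
    have [_ /= fd] := gH _ gx.
    by rewrite /f' max_r ?add0r// subr_le0 ltW.
  move=> x /=; have [f0 _|f0] := ltP 0%R (f x); first exact: (fVG x f0).1.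
  rewrite /f' max_r ?add0r; first by move=> /gH[].
  by rewrite subr_le0 (le_trans f0)// ltW.
rewrite addeAC leeBrDl//.
apply: (@le_trans _ _ (L (fun x => f' x + g x)%R + d)%:E); last first.
  by rewrite EFinD leeD2r// le_inner.
rewrite (meanD mL (unit_bcont uf') (unit_bcont ug)) addrAC.
(* Lowering costs at most [d], since [f - d <= f'] pointwise. *)
rewrite -EFinD lee_fin lerD2r -lerBlDr -[X in (_ - X)%R](mean_cst mL d).
rewrite -(meanB mL (unit_bcont uf) (bcont_cst d)).
apply: (mean_le mL); [|exact: unit_bcont|].
  by apply: bcontB; [exact: unit_bcont|exact: bcont_cst].
by move=> x; rewrite le_max lexx.
Qed.

Let borel_caratheodory :
  (@measurable _ (borel E) : set (set E)) `<=` outer.-cara.-measurable.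
Proof.
apply: smallest_sub; last by move=> G; exact: open_caratheodory.
split => //; [by move=> X mX; rewrite setTD; exact: measurableC |
              by move=> u_ mu_; exact: bigcupT_measurable].
Qed.

(** [outer] retyped on [borel E], so that the measure instances refer to the Borel sets. *)
Let nu : set (borel E) -> \bar R := outer.

Let nu_sigma_additive : semi_sigma_additive nu.
Proof.
move=> F mF tF mUF; apply: caratheodory_measure_sigma_additive => //.
  by move=> i; exact: borel_caratheodory (mF i).
exact: borel_caratheodory.
Qed.

HB.instance Definition _ := isMeasure.Build _ (borel E) R nu
  outer_set0 outer_ge0 nu_sigma_additive.

Let nu_setT : nu setT = 1.
Proof. by rewrite /nu outer_open ?inner_setT//; exact: openT. Qed.

HB.instance Definition _ := Measure_isProbability.Build _ (borel E) R nu nu_setT.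

(** This one-sided bound is enough: slicing turns it into an inequality of integrals, and passing to
    [1 - f] reverses that inequality. *)
Lemma riesz_open : exists mu : probability (borel E) R,
  forall (f : E -> R) (G : set E), unit_cont f -> open G ->
    [set x | 0 < f x]%R `<=` G -> (L f)%:E <= mu G.
Proof.
exists nu => f G uf oG fG.
suff : (L f)%:E <= outer G by [].
by rewrite outer_open//; exact: le_inner.
Qed.

End riesz.

(** * Expectations as positive normalized linear functionals *)

Section expectation_mean.
Context {R : realType} {E : ptopologicalType}.

Lemma bcont_measurable (f : E -> R) : continuous f ->
  measurable_fun [set: borel E] (f : borel E -> R).
Proof.
move=> /continuousP cf; apply: (measurability _ (RGenOpens.measurableE R)).
move=> _ [_ [a [b ->] <-]]; rewrite setTI; apply: sub_sigma_algebra.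
exact/cf/interval_open.
Qed.

Context {d} {T : measurableType d} (P : probability T R) (X : {RV P >-> borel E}).

Lemma bcont_integrable (f : E -> R) : bcont f ->
  P.-integrable setT (EFin \o (fun w => f (X w))).
Proof.
move=> bf; apply: measurable_bounded_integrable => //.
- by rewrite -ge0_fin_numE// fin_num_measure.
- apply: (@measurableT_comp _ _ _ _ (borel E) _ f) => //.
  exact: bcont_measurable bf.1.
- have [_ [M fM]] := bf; exists `|M|; split=> [|y My w _ /=].
    exact: num_real.
  by apply: le_trans (fM _) _; apply: le_trans (ler_norm M) _; exact: ltW.
Qed.

Lemma expectation_bcont_fin_num (f : E -> R) : bcont f ->
  'E_P[fun w => f (X w)]%E \is a fin_num.
Proof.
move=> bf; rewrite unlock; apply: integrable_fin_num => //.
exact: bcont_integrable.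
Qed.

Lemma mean_expectation : mean (fun f : E -> R => fine 'E_P[fun w => f (X w)]%E).
Proof.
split.
- move=> f g bf bg; rewrite unlock.
  rewrite -fineD; [|exact: integrable_fin_num (bcont_integrable bf)|
    exact: integrable_fin_num (bcont_integrable bg)].
  congr fine.
  by rewrite -(integralD_EFin measurableT (bcont_integrable bf) (bcont_integrable bg)).
- move=> c f bf; rewrite unlock.
  under eq_integral do rewrite EFinM.
  rewrite (integralZl measurableT (bcont_integrable bf)) fineM//.
  exact: integrable_fin_num (bcont_integrable bf).
- by move=> f bf f0; apply: fine_ge0; apply: expectation_ge0.
- by rewrite (expectation_cst P 1).
Qed.

End expectation_mean.

Section borel_identity.
Context {E : ptopologicalType}.

(** The canonical random element: under a probability on [borel E], its law is that probability. *)
Definition borel_id : borel E -> borel E := id.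

Let measurable_borel_id : measurable_fun setT borel_id.
Proof. exact: measurable_id. Qed.

HB.instance Definition _ :=
  isMeasurableFun.Build _ _ (borel E) (borel E) borel_id measurable_borel_id.

End borel_identity.

(** The term of index [k] is the part of [y] between the levels [k] and [k + 1]. *)
Lemma sum_slices {R : realType} (y : R) (n : nat) : 0 <= y ->
  \sum_(k < n) Num.min 1 (Num.max (y - k%:R) 0) = Num.min y n%:R.
Proof.
move=> y0; elim: n => [|n IHn]; first by rewrite big_ord0 min_r.
rewrite big_ord_recr/= IHn -natr1.
have [yn|yn] := leP y n%:R.
  rewrite max_r ?subr_le0// (min_r ler01) addr0 min_l//.
  by rewrite (le_trans yn)// lerDl.
rewrite max_l ?subr_ge0 ?(ltW yn)// addr_minr subrKC.
by rewrite minC.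
Qed.

Section riesz_representation.
Context {R : realType} {E : ptopologicalType}.

(* Layer-cake comparison: [n * f] is the sum of the slices
   [min 1 (max (n * f - k) 0)], and each slice dominates the indicator of the
   support of the next one. *)
Let mean_le_slices (L I : (E -> R) -> R) (f : E -> R) :
  mean L -> mean I -> unit_cont f ->
  (forall g h, unit_cont g -> unit_cont h ->
    (forall x, 0 < h x -> g x = 1) -> L h <= I g) ->
  L f <= I f.
Proof.
move=> mL mI uf LI; apply/ler_addgt0Pr => e e0.
near \oo => n.
pose s k x : R := Num.min 1 (Num.max (n.+1%:R * f x - k%:R) 0).
have us k : unit_cont (s k).
  apply: unit_cont_min; first exact: unit_cont1.
    apply: continuous_maxr; last by move=> x; exact: cvg_cst.
    by have [] := bcontB (bcontZ n.+1%:R (unit_bcont uf)) (bcont_cst k%:R).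
  by move=> x; rewrite le_max lexx orbT.
have bs k : bcont (s k) := unit_bcont (us k).
have sumsE : (fun x => \sum_(k < n.+1) s k x) = fun x => n.+1%:R * f x.
  apply/funext => x; have /andP[f0 f1] := uf.2 x.
  by rewrite sum_slices ?mulr_ge0// min_l// ler_piMr.
have sumE (M : (E -> R) -> R) : mean M -> n.+1%:R * M f = \sum_(k < n.+1) M (s k).
  by move=> mM; rewrite -(mean_sum mM)// sumsE (meanZ mM)//; exact: unit_bcont.
(* On the left the slice [s 0] costs at most 1 and [s k.+1] is compared with [s k] on the right; the
   last slice on the right is nonnegative and dropped. Division by [n.+1] makes the error 1
   negligible. *)
have key : n.+1%:R * L f <= 1 + n.+1%:R * I f.
  rewrite !sumE// big_ord_recl big_ord_recr/= lerD//.
    by have /andP[] := mean_unit mL (us 0%N).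
  rewrite -[leLHS]addr0 lerD//; last by have /andP[] := mean_unit mI (us n).
  apply: ler_sum => k _; apply: LI => // x.
  rewrite /s lt_min ltr01/= lt_max ltxx orbF subr_gt0 /bump/= add1n => kf.
  rewrite min_l// le_max; apply/orP; left.
  by rewrite lerBrDr addrC natr1 ltW.
rewrite -(ler_pM2l (_ : 0 < n.+1%:R :> R))// mulrDr addrC (le_trans key)//.
rewrite lerD2r -ler_pdivrMr// div1r (@le_trans _ _ n%:R) ?ler_nat//.
by near: n; exact: nbhs_infty_ger.
Unshelve. all: by end_near. Qed.

Lemma riesz_representation (L : (E -> R) -> R) :
  open_cozero R E -> mean L -> smooth_mean L ->
  exists mu : probability (borel E) R,
    forall f, bcont f -> ('E_mu[f] = (L f)%:E)%E.
Proof.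
move=> coz mL sL; have [mu muP] := riesz_open coz mL sL; exists mu.
pose X : {RV mu >-> borel E} := borel_id.
pose I (f : E -> R) := fine 'E_mu[fun w => f (X w)]%E.
have mI : mean I := mean_expectation X.
(* The open set where [h] is positive lies in between: [L h] is at most its measure, and its
   indicator is at most [g]. *)
have LI g h : unit_cont g -> unit_cont h ->
    (forall x, 0 < h x -> g x = 1) -> L h <= I g.
  move=> ug uh hg; rewrite -lee_fin fineK; last first.
    exact: expectation_bcont_fin_num (unit_bcont ug).
  have oG : open [set x | 0 < h x].
    apply: (@open_comp _ _ h [set y | 0 < y]); last exact: open_gt.
    by move=> x _; exact: uh.1.
  apply: le_trans (muP h _ uh oG _) _ => //.
  have mG : measurable ([set x | 0 < h x] : set (borel E)).
    exact: sub_sigma_algebra.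
  rewrite -(expectation_indic mu mG); apply: expectation_le => //.
  - exact: bcont_measurable ug.1.
  - by move=> x; have /andP[] := ug.2 x.
  - apply: aeW => x; rewrite indicE; case: (boolP (x \in _)) => [|_].
      by rewrite inE => /hg ->.
    by have /andP[] := ug.2 x.
have unitE f : unit_cont f -> L f = I f.
  move=> uf; apply/eqP; rewrite eq_le; apply/andP; split.
    exact: mean_le_slices.
  have uf' : unit_cont (fun x => 1 - f x).
    split; first by have [] := bcontB (bcont_cst 1) (unit_bcont uf).
    move=> x; have /andP[f0 f1] := uf.2 x.
    by rewrite subr_ge0 f1/= lerBlDr lerDl.
  have := mean_le_slices mL mI uf' LI.
  rewrite (meanB mL (bcont_cst 1) (unit_bcont uf)).
  rewrite (meanB mI (bcont_cst 1) (unit_bcont uf)).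
  by rewrite (mean_cst mL) (mean_cst mI) lerD2l lerN2.
move=> f bf; have [cf [M fM]] := bf.
rewrite -[LHS]fineK; last exact: (expectation_bcont_fin_num X bf).
congr EFin; rewrite -/(I f).
(* The added 1 makes [N] positive; [u] is then [f] rescaled affinely from [[-N, N]] to [[0, 1]]. *)
pose N := `|M| + 1.
have N0 : 0 < N by rewrite ltr_pwDr.
pose u x := (2 * N)^-1 * (f x + N).
have fN x : `|f x| <= N by rewrite (le_trans (fM x))// (le_trans (ler_norm M))// lerDl.
have bu : bcont u by apply: bcontZ; apply: bcontD => //; exact: bcont_cst.
have uu : unit_cont u.
  split; first exact: bu.1.
  move=> x; have := fN x; rewrite ler_norml => /andP[f1 f2].
  rewrite /u mulr_ge0 ?invr_ge0 ?mulr_ge0//= ?(ltW N0)//; last lra.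
  by rewrite ler_pdivrMl ?mulr_gt0// mulr1; lra.
have fE : f = fun x => 2 * N * u x + - N.
  by apply/funext => x; rewrite /u mulrA mulfV ?mul1r ?addrK// mulf_neq0// gt_eqF.
rewrite fE (meanD mL (bcontZ _ bu) (bcont_cst _)) (meanD mI (bcontZ _ bu) (bcont_cst _)).
by rewrite (meanZ mL)// (meanZ mI)// (mean_cst mL) (mean_cst mI) unitE.
Qed.

End riesz_representation.

(** * Tightness implies Daniell's condition *)

Section tight_mean.
Context {R : realType} {E : topologicalType}.

(* Dini's theorem on the compact set, tightness outside of it. *)
Lemma tight_smooth_mean (L : (E -> R) -> R) : mean L ->
  (forall e, 0 < e -> exists (K : set E) (g : E -> R), [/\ compact K, bcont g,
    (forall x, 0 <= g x), (forall x, ~ K x -> 1 <= g x) & L g < e]) ->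
  smooth_mean L.
Proof.
move=> mL tL f uf f_mono f0.
have f_anti m n x : (m <= n)%N -> f n x <= f m x.
  move=> /subnK <-; elim: (n - m)%N => // k; rewrite addSn.
  exact: le_trans.
apply/cvgrPdist_le => e e0.
have e20 : 0 < e / 2 by rewrite divr_gt0.
have [K [g [cK bg g0 gK Lg]]] := tL _ e20.
have fK : \forall n \near \oo, K `<=` [set x | f n x < e / 2].
  have /compact_near_coveringP := cK.
  apply => x Kx.
  have [k _ /(_ k (leqnn k))/= fk] : \forall k \near \oo, f k x < e / 2.
    exact: (cvgr_lt 0 (f0 x)).
  have : \forall x' \near x, f k x' < e / 2.
    by apply: (cvgr_lt (f k x)) => //; exact: (uf k).1.
  move=> fx'; near=> x' n => /=.
  apply: (@le_lt_trans _ _ (f k x')); last by near: x'.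
  by apply: f_anti; near: n; exact: nbhs_infty_ge.
near=> n; rewrite sub0r normrN /=.
have /andP[L0 _] := mean_unit mL (uf n); rewrite ger0_norm//.
(* [f n <= e / 2 + g] everywhere: on [K] by the first term, off [K] because [f n <= 1 <= g]. *)
apply: (@le_trans _ _ (L (fun x => e / 2 + g x))).
  apply: (mean_le mL); first exact: unit_bcont.
    by apply: bcontD => //; exact: bcont_cst.
  move=> x; have [Kx|Kx] := pselect (K x).
    rewrite -[leLHS]addr0 lerD//; apply/ltW; move: x Kx; near: n.
    exact: fK.
  have /andP[_ f1] := (uf n).2 x; rewrite (le_trans f1)// (le_trans (gK _ Kx))//.
  by rewrite lerDr ltW.
rewrite (meanD mL (bcont_cst _) bg) (mean_cst mL).
by rewrite [leRHS]splitr lerD// ltW.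
Unshelve. all: by end_near. Qed.

End tight_mean.

(** * Moments *)

Section polarization.
Context {R : numFieldType} {J : finType}.
Implicit Types (z : J -> R) (e : {ffun J -> bool}).

Let sgn e : R := \prod_j (-1) ^+ (~~ e j).

(** The number of permutations of [J], that is, the factorial of [#|J|]. *)
Let inj_card : R := \sum_(f : {ffun J -> J} | injectiveb f) 1.

Let inj_card_neq0 : inj_card != 0.
Proof.
rewrite /inj_card sumr_const pnatr_eq0 -lt0n; apply/card_gt0P.
by exists [ffun j => j]; apply/injectiveP => i j; rewrite !ffunE.
Qed.

(* The signed sum over the subsets [e] containing the image of [f] vanishes
   unless [f] is onto. *)
Let sum_sgn (f : {ffun J -> J}) :
  \sum_e sgn e * \prod_j (e (f j))%:R = (injectiveb f)%:R.
Proof.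
(* The sum over subsets factors over the points [i]: a point outside the image of [f] gives
   [1 - 1 = 0], a point in the image gives 1. *)
transitivity (\prod_(i : J) \sum_(b : bool)
    ((-1) ^+ (~~ b) * \prod_(j | f j == i) b%:R : R)).
  rewrite bigA_distr_bigA; apply: eq_bigr => e _.
  rewrite big_split/=; congr (_ * _).
  rewrite (partition_big f xpredT)//=; apply: eq_bigr => i _.
  by apply: eq_bigr => j /eqP ->.
have [injf|ninjf] := boolP (injectiveb f).
  rewrite big1// => i _; rewrite big_bool/= expr0 big1 ?mulr1//.
  have /injectiveP/injF_onto/(_ i)/codomP[j ->] := injf.
  by rewrite (bigD1 j)//= mul0r mulr0 addr0.
have [i fi] : exists i, forall j, f j != i.
  have /subsetPn[i _ fi] : ~~ (predT \subset codom f).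
    apply: contra ninjf => /subset_leq_card leJ.
    have /image_injP injf : #|[seq f j | j in J]| == #|J|.
      by rewrite eqn_leq leq_image_card/=.
    by apply/injectiveP => i j; exact: injf.
  by exists i => j; apply: contra fi => /eqP <-; exact: codom_f.
apply/eqP; rewrite prodf_seq_eq0/=; apply/hasP; exists i; first exact: mem_index_enum.
by rewrite big_bool/= !big_pred0 ?mulr1 ?expr0 ?expr1 ?subrr// => j; exact/negbTE.
Qed.

(** Expand the power over all maps from [J] to [J]: the signs cancel those that are not injective,
    and each permutation contributes the whole product. The linear forms have coefficients 0 or 1,
    hence nonnegative. *)
Lemma polarization : exists c : {ffun J -> bool} -> R, forall z,
  \prod_j z j = \sum_e c e * (\sum_j (e j)%:R * z j) ^+ #|J|.
Proof.
exists (fun e => inj_card^-1 * sgn e) => z.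
rewrite -[LHS](mulKf inj_card_neq0).
under [RHS]eq_bigr do rewrite -mulrA.
rewrite -big_distrr/=; congr (_ * _).
transitivity (\sum_(f : {ffun J -> J}) (injectiveb f)%:R * \prod_j z (f j)).
  rewrite /inj_card big_distrl/= big_mkcond/=; apply: eq_bigr => f _.
  case: ifPn => [injf|_]; last by rewrite mul0r.
  by congr (_ * _); rewrite (reindex_inj (injectiveP _ injf)).
under [RHS]eq_bigr do rewrite -prodr_const bigA_distr_bigA big_distrr/=.
rewrite exchange_big/=; apply: eq_bigr => f _.
rewrite -sum_sgn big_distrl/=; apply: eq_bigr => e _.
by rewrite big_split/= mulrA.
Qed.

End polarization.

Section lin_comb_monomial.
Context {R : realType} {d : nat}.
Implicit Types (t : 'I_d -> R) (x : 'rV[R]_d) (k : 'I_d -> nat).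

Lemma prod_coord (J : finType) (f : J -> 'I_d) x :
  \prod_j x ord0 (f j) = monomial (fun i => #|[pred j | f j == i]|) x.
Proof.
rewrite (partition_big f xpredT)//=; apply: eq_bigr => i _.
by rewrite -prodr_const; apply: eq_bigr => j /eqP ->.
Qed.

Lemma lin_comb_exp t x m : lin_comb t x ^+ m =
  \sum_(f : {ffun 'I_m -> 'I_d}) (\prod_j t (f j)) *
    monomial (fun i => #|[pred j | f j == i]|) x.
Proof.
rewrite -[X in _ ^+ X]card_ord -prodr_const bigA_distr_bigA.
by apply: eq_bigr => f _; rewrite big_split/= prod_coord.
Qed.

(** The reason why directions in the nonnegative orthant suffice to recover all mixed moments. *)
Lemma monomial_lin_comb k : exists (I : finType) (c : I -> R)
    (t : I -> 'I_d -> R) (m : nat), (forall i j, 0 <= t i j) /\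
  forall x, monomial k x = \sum_i c i * lin_comb (t i) x ^+ m.
Proof.
(* One point for each factor of the monomial; the coefficient of coordinate [i] will be the number
   of chosen points over [i]. *)
pose J : finType := {i : 'I_d & 'I_(k i)}.
have [c prodE] := @polarization R J.
exists {ffun J -> bool}, c.
exists (fun (e : {ffun J -> bool}) i => \sum_(j : J | tag j == i) (e j)%:R), #|J|; split.
  by move=> e i; apply: sumr_ge0 => j _; exact: ler0n.
move=> x; transitivity (\prod_(j : J) x ord0 (tag j)).
  transitivity (\prod_i \prod_(l : 'I_(k i)) x ord0 i).
    by apply: eq_bigr => i _; rewrite prodr_const card_ord.
  by rewrite (sig_big_dep xpredT (fun _ => xpredT) (fun i _ => x ord0 i)).
rewrite prodE; apply: eq_bigr => e _; congr (_ * _ ^+ _).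
rewrite (partition_big (fun j : J => tag j) xpredT)//=; apply: eq_bigr => i _.
by rewrite big_distrl/=; apply: eq_bigr => j /eqP ->.
Qed.

End lin_comb_monomial.

(** * From bounded to unbounded continuous test functions *)

Lemma truncated_expectation_cvg {R : realType} {d} {T : measurableType d}
    (P : probability T R) (Z : T -> R) :
  measurable_fun setT Z -> (forall w, 0 <= Z w) ->
  ('E_P[fun w => Num.min (Z w) n%:R])%E @[n --> \oo] --> (\int[P]_w (Z w)%:E)%E.
Proof.
move=> mZ Z0.
pose g n w : \bar R := (Num.min (Z w) n%:R)%:E.
have limg w : limn (g ^~ w) = (Z w)%:E.
  apply: cvg_lim => //; apply: cvg_near_cst; near=> n.
  by rewrite /g min_l//; near: n; exact: nbhs_infty_ger.
rewrite unlock (_ : (\int[P]_w (Z w)%:E = \int[P]_w limn (g ^~ w))%E); last first.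
  by apply: eq_integral => w _; rewrite limg.
apply: (cvg_monotone_convergence measurableT) => [n|n w _|w _ m n mn].
- by apply/measurable_EFinP; apply: measurable_minr => //; exact: measurable_cst.
- by rewrite lee_fin le_min Z0/=.
- by rewrite lee_fin le_min ge_min lexx/= ge_min ler_nat mn orbT.
Unshelve. all: by end_near. Qed.

Section equal_expectations.
Context {R : realType} {d1} {T1 : measurableType d1} {P1 : probability T1 R}
  {d2} {T2 : measurableType d2} {P2 : probability T2 R}.
Context (A : T1 -> R) (B : T2 -> R).
Hypotheses (mA : measurable_fun setT A) (mB : measurable_fun setT B).
Hypothesis EAB : forall g : R -> R, bcont g ->
  ('E_P1[fun w => g (A w)] = 'E_P2[fun w => g (B w)])%E.

(** The truncations of [h] at level [n] are bounded, so [EAB] applies to them; monotone convergence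
    removes the truncation. *)
Let eq_ge0_integral (h : R -> R) : continuous h -> (forall x, 0 <= h x) ->
  (\int[P1]_w (h (A w))%:E = \int[P2]_w (h (B w))%:E)%E.
Proof.
move=> ch h0; have mh := continuous_measurable_fun ch.
have cA := truncated_expectation_cvg (P := P1)
  (measurableT_comp mh mA) (fun w => h0 (A w)).
have cB := truncated_expectation_cvg (P := P2)
  (measurableT_comp mh mB) (fun w => h0 (B w)).
apply: (cvg_unique _ cA) => //; apply: cvg_trans cB.
rewrite (_ : (fun n => _) = fun n => 'E_P2[fun w => Num.min ((h \o B) w) n%:R]%E)//.
apply/funext => n /=.
apply: (EAB (g := fun x => Num.min (h x) n%:R)); split.
  by apply: continuous_minr => // x; exact: cvg_cst.
by exists n%:R => x; rewrite ger0_norm ?le_min ?h0//= ge_min lexx orbT.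
Qed.

Lemma eq_continuous_integrable (h : R -> R) : continuous h ->
  P2.-integrable setT (fun w => (h (B w))%:E) ->
  P1.-integrable setT (fun w => (h (A w))%:E).
Proof.
move=> ch /integrableP[_ hB]; apply/integrableP; split.
  by apply/measurable_EFinP/measurableT_comp => //; exact: continuous_measurable_fun.
rewrite (eq_ge0_integral (h := fun x => `|h x|))// => x.
by apply: cvg_norm; exact: ch.
Qed.

Lemma eq_continuous_integral (h : R -> R) : continuous h ->
  (\int[P1]_w (h (A w))%:E = \int[P2]_w (h (B w))%:E)%E.
Proof.
move=> ch; rewrite [LHS]integralE [RHS]integralE.
have hp : continuous (fun x => Num.max (h x) 0).
  by apply: continuous_maxr => // x; exact: cvg_cst.
have hn : continuous (fun x => Num.max (- h x) 0).
  apply: continuous_maxr => x; last exact: cvg_cst.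
  by apply: cvgN; exact: ch.
have := eq_ge0_integral hp; have := eq_ge0_integral hn.
move=> En Ep; congr (_ - _)%E.
- under eq_integral do rewrite funeposE -EFin_max.
  under [RHS]eq_integral do rewrite funeposE -EFin_max.
  by apply: Ep => x; rewrite le_max lexx orbT.
- under eq_integral do rewrite funenegE -EFinN -EFin_max.
  under [RHS]eq_integral do rewrite funenegE -EFinN -EFin_max.
  by apply: En => x; rewrite le_max lexx orbT.
Qed.

End equal_expectations.

Section equal_moments.
Context {R : realType} {d : nat} {d1} {T1 : measurableType d1}
  {P1 : probability T1 R} {d2} {T2 : measurableType d2} {P2 : probability T2 R}.
Context (Y : {RVec P1 >-> R ^ d}) (X : {RVec P2 >-> R ^ d}).

Lemma continuous_lin_comb (t : 'I_d -> R) : continuous (lin_comb t : 'rV[R]_d -> R).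
Proof.
apply: (@continuous_big _ _ +%R 0 xpredT).
  by move=> [x y]; apply: cvgD; [exact: cvg_fst|exact: cvg_snd].
move=> i _ x.
exact: (cvgM (cvg_cst (t i)) (@coord_continuous R 1 d ord0 i x)).
Qed.

Hypothesis EYX : forall t : 'I_d -> R, (forall i, 0 <= t i) ->
  forall g : R -> R, bcont g ->
  ('E_P1[fun w => g (lin_comb t (Y w))] = 'E_P2[fun w => g (lin_comb t (X w))])%E.
Hypothesis finX : finite_mixed_moments X.

Let mY (t : 'I_d -> R) : measurable_fun setT (fun w => lin_comb t (Y w)).
Proof.
apply: (@measurableT_comp _ _ _ _ (borel 'rV[R]_d) _ (lin_comb t)) => //.
by apply: bcont_measurable; exact: continuous_lin_comb.
Qed.

Let mX (t : 'I_d -> R) : measurable_fun setT (fun w => lin_comb t (X w)).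
Proof.
apply: (@measurableT_comp _ _ _ _ (borel 'rV[R]_d) _ (lin_comb t)) => //.
by apply: bcont_measurable; exact: continuous_lin_comb.
Qed.

Let integrable_lin_comb_exp (t : 'I_d -> R) m :
  P2.-integrable setT (fun w => (lin_comb t (X w) ^+ m)%:E).
Proof.
under eq_fun do rewrite lin_comb_exp -sumEFin.
apply: integrable_sum => // f _.
under eq_fun do rewrite EFinM.
exact: integrableZl.
Qed.

Let continuous_exp m : continuous (fun x : R => x ^+ m).
Proof. by move=> x; exact: exprn_continuous. Qed.

Lemma eq_mixed_moments : finite_mixed_moments Y /\
  forall k, mixed_moment Y k = mixed_moment X k.
Proof.
apply/all_and2 => k.
have [I [c [t [m [t0 monoE]]]]] := monomial_lin_comb (R := R) k.
have iX i : P2.-integrable setT (fun w => (c i * lin_comb (t i) (X w) ^+ m)%:E).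
  by under eq_fun do rewrite EFinM; exact: integrableZl.
(* Integrability passes from [X] to [Y], because the integrals of the absolute values agree. *)
have iY i : P1.-integrable setT (fun w => (c i * lin_comb (t i) (Y w) ^+ m)%:E).
  under eq_fun do rewrite EFinM; apply: integrableZl => //.
  apply: (eq_continuous_integrable (mY (t i)) (mX (t i)) (EYX (t0 i))
    (h := fun x => x ^+ m)); first exact: continuous_exp.
  exact: integrable_lin_comb_exp.
have YE w : (monomial k (Y w))%:E = (\sum_i (c i * lin_comb (t i) (Y w) ^+ m)%:E)%E.
  by rewrite monoE -sumEFin.
have XE w : (monomial k (X w))%:E = (\sum_i (c i * lin_comb (t i) (X w) ^+ m)%:E)%E.
  by rewrite monoE -sumEFin.
split; first by under eq_fun do rewrite YE; exact: integrable_sum.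
rewrite /mixed_moment unlock.
under eq_integral do rewrite YE; under [RHS]eq_integral do rewrite XE.
rewrite !integral_sum//; apply: eq_bigr => i _.
apply: (eq_continuous_integral (mY (t i)) (mX (t i)) (EYX (t0 i))
  (h := fun x => c i * x ^+ m)).
by move=> x; apply: cvgM; [exact: cvg_cst|exact: continuous_exp].
Qed.

End equal_moments.

(** * Ultrafilter limits *)

Section ultrafilter_limits.

(** Compactness gives a cluster point, and an ultrafilter converges to each of its cluster
    points. *)
Lemma ultra_cvg_compact (I : Type) (T : topologicalType) (U : set_system I)
    (UU : UltraFilter U) (u : I -> T) (K : set T) :
  compact K -> (forall i, K (u i)) -> exists l : T, u @ U --> l.
Proof.
move=> cK uK; have [|l [_ ul]] := cK (u @ U) _.
  by apply: (@filterS _ U _ setT) => [i _|]; [exact: uK|exact: filterT].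
exists l => V lV.
have [//|UV] := in_ultra_setVsetC (u @^-1` V) UU.
by have [x []] := ul (~` V) V UV lV.
Qed.

(** If the preimage of a neighbourhood of [l] were not in [F], its complement could be added to [F],
    and an ultrafilter finer than the result would violate the hypothesis. *)
Lemma cvg_ultra (I : Type) (T : topologicalType) (F : set_system I) (u : I -> T)
    (l : T) : Filter F ->
  (forall U : set_system I, UltraFilter U -> F `<=` U -> u @ U --> l) -> u @ F --> l.
Proof.
move=> FF ul V lV; apply: contrapT => FV.
pose D := ~` (u @^-1` V).
have pD : ProperFilter (within D F).
  apply: (Build_ProperFilter _ (within_filter D FF)).
  move=> FD; apply: FV; have {}FD : F (fun i => D i -> False) := FD.
  suff : F (u @^-1` V) by [].
  by apply: filterS FD => i nD; apply: contrapT => nV; exact: nD.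
have [U [UU DU]] := ultraFilterLemma pD.
have FU : F `<=` U by move=> W FW; apply: DU; apply: filterS FW.
have UD : U D by apply: DU; exact: (@filterS _ F _ setT _ _ filterT).
have UV : U (u @^-1` V) by exact: ul.
by have [x [Dx Vx]] := filter_ex (filterI UD UV).
Qed.

Context {R : realType} {E : topologicalType} {I : Type}.
Context (M : I -> (E -> R) -> R) (mM : forall i, mean (M i)).
Context (U : set_system I) {UU : UltraFilter U}.

(** The limit exists for [bcont] functions: bounds on [f] confine the values [M i f] to a compact
    segment. *)
Definition ultra_mean (f : E -> R) : R := lim (M i f @[i --> U]).

Lemma ultra_mean_cvg f : bcont f -> M i f @[i --> U] --> ultra_mean f.
Proof.
move=> bf; have [_ [b fb]] := bf.
suff [l Ml] : exists l : R, M i f @[i --> U] --> l.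
  have : cvg (M i f @[i --> U]) by apply/cvg_ex; exists l.
  by [].
apply: (ultra_cvg_compact UU (@segment_compact R (- b) b)) => i.
rewrite /= in_itv/= -{1}(mean_cst (mM i) (- b)) -{2}(mean_cst (mM i) b).
by apply/andP; split; apply: (mean_le (mM i)) => //; try exact: bcont_cst;
  move=> x; have := fb x; rewrite ler_norml => /andP[].
Qed.

Lemma ultra_meanE f l : M i f @[i --> U] --> l -> ultra_mean f = l.
Proof. by move=> Ml; apply: cvg_lim. Qed.

Lemma mean_ultra : mean ultra_mean.
Proof.
split.
- move=> f g bf bg; apply: ultra_meanE.
  under eq_fun do rewrite (meanD (mM _) bf bg).
  by apply: cvgD; exact: ultra_mean_cvg.
- move=> c f bf; apply: ultra_meanE.
  under eq_fun do rewrite (meanZ (mM _) c bf).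
  by apply: cvgM; [exact: cvg_cst|exact: ultra_mean_cvg].
- move=> f bf f0; apply: limr_ge; first exact: ultra_mean_cvg.
  by apply: nearW => i; exact: (mean_ge0 (mM i)).
- apply: ultra_meanE; under eq_fun do rewrite (mean1 (mM _)).
  exact: cvg_cst.
Qed.

End ultrafilter_limits.

(** * Tightness from the coordinates *)

Section tightness.
Context {R : realType}.

(** A continuous substitute for the indicator of large [|s|]: 0 up to [n], 1 from [n + 1] on. *)
Definition tail (n : nat) (s : R) : R := Num.min 1 (Num.max (`|s| - n%:R) 0).

Lemma unit_cont_tail n : unit_cont (tail n).
Proof.
apply: unit_cont_min; first exact: unit_cont1.
  apply: continuous_maxr; last by move=> x; exact: cvg_cst.
  by move=> x; apply: cvgB; [exact: norm_continuous|exact: cvg_cst].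
by move=> x; rewrite le_max lexx orbT.
Qed.

Lemma tail1 n s : n.+1%:R <= `|s| -> tail n s = 1.
Proof.
by move=> ns; rewrite /tail min_l// le_max lerBrDr addrC natr1 ns.
Qed.

Lemma tail_expectation_cvg0 {d} {T : measurableType d} (P : probability T R)
    (Z : T -> R) : measurable_fun setT Z ->
  ('E_P[fun w => tail n (Z w)])%E @[n --> \oo] --> 0%E.
Proof.
move=> mZ; rewrite unlock.
have [] := @dominated_convergence _ T R P setT measurableT
  (fun n w => (tail n (Z w))%:E) (cst 0%E) (cst 1%E).
- move=> n; apply/measurable_EFinP; apply: measurableT_comp => //.
  by apply: continuous_measurable_fun; exact: (unit_cont_tail n).1.
- exact: measurable_cst.
- apply: aeW => w _; apply: cvg_near_cst; near=> n.
  rewrite /tail max_r ?min_r// subr_le0.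
  by near: n; exact: nbhs_infty_ger.
- exact: finite_measure_integrable_cst.
- apply: aeW => w n _; have /andP[t0 t1] := (unit_cont_tail n).2 (Z w).
  by rewrite gee0_abs lee_fin.
by move=> _ _; rewrite integral0.
Unshelve. all: by end_near. Qed.

Context {d : nat} (L : ('rV[R]_d -> R) -> R) (mL : mean L).

Lemma coord_tight_smooth_mean :
  (forall i, L (fun x => tail n (x ord0 i)) @[n --> \oo] --> (0 : R)) ->
  smooth_mean L.
Proof.
move=> L0; apply: tight_smooth_mean => // e e0.
(* Dividing by [d.+1] keeps the sum of [d] such bounds strictly below [e]. *)
have ed0 : 0 < e / d.+1%:R by rewrite divr_gt0.
have bt n (i : 'I_d) : bcont (fun x : 'rV[R]_d => tail n (x ord0 i)).
  apply: unit_bcont; split; last by move=> x; exact: (unit_cont_tail n).2.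
  move=> x; apply: (@continuous_comp _ _ _ (fun x : 'rV[R]_d => x ord0 i) (tail n)).
    exact: coord_continuous.
  exact: (unit_cont_tail n).1.
have [n _ /(_ n (leqnn n))/= tn] : \forall n \near \oo, forall i : 'I_d,
    L (fun x => tail n (x ord0 i)) < e / d.+1%:R.
  by apply: filter_forall => i; exact: (cvgr_lt 0 (L0 i)).
(* Outside this cube some coordinate has absolute value above [n + 1], where its [tail n] equals
   1. *)
exists [set x : 'rV[R]_d | forall i, `[- n.+1%:R, n.+1%:R]%classic (x ord0 i)].
exists (fun x => \sum_(i < d) tail n (x ord0 i)); split.
- apply: (@rV_compact R d (fun=> `[- n.+1%:R, n.+1%:R]%classic)) => _.
  exact: segment_compact.
- exact: bcont_sum.
- by move=> x; apply: sumr_ge0 => i _; have /andP[] := (unit_cont_tail n).2 (x ord0 i).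
- move=> x /existsNP[i] /=; rewrite in_itv/= -ler_norml => /negP.
  rewrite -ltNge => /ltW nx.
  rewrite (bigD1 i)//= tail1// lerDl; apply: sumr_ge0 => j _.
  by have /andP[] := (unit_cont_tail n).2 (x ord0 j).
- rewrite (mean_sum mL)//.
  apply: (@le_lt_trans _ _ (\sum_(i < d) e / d.+1%:R)).
    by apply: ler_sum => i _; exact/ltW.
  rewrite sumr_const card_ord -mulrnAr -mulr_natl gtr_pMr//.
  by rewrite -[ltRHS](@mulfV _ d.+1%:R)// ltr_pM2r ?invr_gt0// ltr_nat.
Qed.

End tightness.

(** * Identification of the limit along an ultrafilter *)

Section vector_convergence.
Context {R : realType} {d : nat}.
Context {dn : nat -> measure_display} {Tn : forall n, measurableType (dn n)}
  {Pn : forall n, probability (Tn n) R} (Xn : forall n, {RVec (Pn n) >-> R ^ d}).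
Context {d0 : measure_display} {T : measurableType d0} {P : probability T R}
  (X : {RVec P >-> R ^ d}).
Hypothesis hcvg : forall t : 'I_d -> R, (forall i, 0 <= t i) ->
  cvg_in_distribution Pn (fun n w => lin_comb t (Xn n w)) P
    (fun w => lin_comb t (X w)).
Hypothesis hdet : determined_by_moments X.

Let bcont_lin_comb (t : 'I_d -> R) (g : R -> R) : bcont g ->
  bcont (fun x : 'rV[R]_d => g (lin_comb t x)).
Proof.
move=> [cg [b gb]]; split; last by exists b => x.
move=> x; apply: (@continuous_comp _ _ _ (lin_comb t : 'rV[R]_d -> R) g).
  exact: continuous_lin_comb.
exact: cg.
Qed.

Let M n (f : 'rV[R]_d -> R) := fine 'E_(Pn n)[fun w => f (Xn n w)]%E.

Let mM n : mean (M n) := mean_expectation (Xn n).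

Let eq_expectation_distribution (mu : probability (borel 'rV[R]_d) R) :
  same_distribution (borel_id : {RV mu >-> borel 'rV[R]_d}) X ->
  forall f, bcont f -> ('E_mu[f] = 'E_P[fun w => f (X w)])%E.
Proof.
move=> muX f bf; rewrite unlock.
rewrite (@eq_measure_integral _ _ _ _ (distribution P X)); last first.
  by move=> A mA _; exact: (muX A mA).
rewrite integral_distribution//; last exact: bcont_integrable.
by apply/measurable_EFinP; exact: bcont_measurable bf.1.
Qed.

Lemma ultra_cvg_expectation (U : set_system nat) : UltraFilter U -> \oo `<=` U ->
  forall f, bcont f ->
  ('E_(Pn n)[fun w => f (Xn n w)])%E @[n --> U] --> ('E_P[fun w => f (X w)])%E.
Proof.
move=> UU ooU.
pose L := ultra_mean M U.
have mL : mean L := mean_ultra mM (UU := UU).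
have Llin (t : 'I_d -> R) (g : R -> R) : (forall i, 0 <= t i) -> bcont g ->
    L (fun x => g (lin_comb t x)) = fine 'E_P[fun w => g (lin_comb t (X w))]%E.
  move=> t0 bg.
  have finE : ('E_P[fun w => g (lin_comb t (X w))])%E \is a fin_num.
    exact: (expectation_bcont_fin_num X (bcont_lin_comb t bg)).
  (* The hypothesis gives the limit along [\oo], hence along the finer [U]; this computes [L] on
     functions of a nonnegative linear form. *)
  have EnE : (fun n => M n (fun x => g (lin_comb t x))) @ \oo -->
      fine 'E_P[fun w => g (lin_comb t (X w))]%E.
    apply: fine_cvg; rewrite fineK//.
    by apply: (hcvg t0 (f := g)); [exact: bg.1|exact: bounded_bcont].
  by apply: ultra_meanE => V /EnE; exact: ooU.
have sL : smooth_mean L.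
  apply: coord_tight_smooth_mean => // i.
  (* The unit vector [e_i] is a nonnegative direction, so the tails of coordinate [i] under [L] are
     those of the fixed variable [X_i]. *)
  pose t (j : 'I_d) : R := (j == i)%:R.
  have tE (x : 'rV[R]_d) : lin_comb t x = x ord0 i.
    rewrite /lin_comb (bigD1 i)//= /t eqxx mul1r big1 ?addr0// => j /negbTE ->.
    by rewrite mul0r.
  have LE n : L (fun x => tail n (x ord0 i)) =
      fine 'E_P[fun w => tail n (lin_comb t (X w))]%E.
    rewrite -Llin; [|by move=> j; exact: ler0n|exact/unit_bcont/unit_cont_tail].
    by congr L; apply/funext => x; rewrite tE.
  under eq_fun do rewrite LE.
  apply: fine_cvg; apply: tail_expectation_cvg0.
  apply: (@measurableT_comp _ _ _ _ (borel 'rV[R]_d) _ (lin_comb t)) => //.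
  by apply: bcont_measurable; exact: continuous_lin_comb.
have [mu muL] := @riesz_representation R 'rV[R]_d L
  (@pseudometric_open_cozero R 'rV[R]_d) mL sL.
pose Y : {RV mu >-> borel 'rV[R]_d} := borel_id.
have [finY momY] : finite_mixed_moments Y /\
    forall k, mixed_moment Y k = mixed_moment X k.
  apply: eq_mixed_moments => [t t0 g bg|]; last exact: hdet.1.
  have := muL _ (bcont_lin_comb t bg); rewrite Llin// fineK//.
  exact: (expectation_bcont_fin_num X (bcont_lin_comb t bg)).
have YX : same_distribution Y X by exact: hdet.2.
move=> f bf; rewrite -(eq_expectation_distribution YX bf) (muL _ bf).
apply: cvg_EFin; last exact: (ultra_mean_cvg mM bf).
by apply: nearW => n; exact: (expectation_bcont_fin_num (Xn n) bf).
Qed.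

End vector_convergence.

Theorem theorem6p1 (R : realType) (d : nat) (hd : (1 <= d)%N)
    (dn : nat -> measure_display) (Tn : forall n, measurableType (dn n))
    (Pn : forall n, probability (Tn n) R)
    (Xn : forall n, {RVec (Pn n) >-> R ^ d})
    (d0 : measure_display) (T : measurableType d0) (P : probability T R)
    (X : {RVec P >-> R ^ d})
    (hcvg : forall t : 'I_d -> R, (forall i, 0 <= t i) ->
      cvg_in_distribution Pn (fun n w => lin_comb t (Xn n w))
        P (fun w => lin_comb t (X w)))
    (hdet : determined_by_moments X) :
  cvg_in_distribution (E := 'rV[R]_d) Pn (fun n => Xn n) P X /\
  forall t : 'I_d -> R,
    cvg_in_distribution Pn (fun n w => lin_comb t (Xn n w))
      P (fun w => lin_comb t (X w)).
Proof.
have XnX : cvg_in_distribution (E := 'rV[R]_d) Pn (fun n => Xn n) P X.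
  move=> f cf bf; apply: cvg_ultra => U UU ooU.
  by apply: (ultra_cvg_expectation hcvg hdet UU ooU); exact: bcont_bounded.
(* For arbitrary real [t] this is the continuous mapping theorem applied to [lin_comb t]. *)
split => // t g cg bg.
have [_ [b gb]] := bcont_bounded cg bg.
apply: (XnX (fun x => g (lin_comb t x))).
  move=> x; apply: (@continuous_comp _ _ _ (lin_comb t : 'rV[R]_d -> R) g).
    exact: continuous_lin_comb.
  exact: cg.
apply: bounded_bcont; split; last by exists b => x.
move=> x; apply: (@continuous_comp _ _ _ (lin_comb t : 'rV[R]_d -> R) g).
  exact: continuous_lin_comb.
exact: cg.
Qed.
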